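(* Let $p(\bar{x})=\{\varphi(\bar{x},\bar{a}_\beta):\beta<\lambda\}$ be a graph-like $\lambda$-type of $\widehat{\mathcal{M}}=\prod_{\alpha<\lambda}\mathcal{M}_\alpha/\mathcal{D}$, with representatives witnessing that it is graph-like and Łoś map $L$ with respect to them. Then $p(\bar{x})$ is realized in $\widehat{\mathcal{M}}$ if and only if $\eta_L[\lambda]\subseteq A$ for some internal subset $A$ of $\mathbb{G}_L$ that induces a complete subgraph of $\mathbb{G}_L$.
   Context: $\lambda$ is an infinite cardinal, $\mathcal{D}$ a regular ultrafilter on $\lambda$, $(\mathcal{M}_\alpha)_{\alpha<\lambda}$ structures in a common language; $\mathcal{P}_\omega(\lambda)$ the finite subsets of $\lambda$, $[X]^2$ the 2-element subsets. Given representatives $\bar r_\beta\in\prod_\alpha\mathcal{M}_\alpha$ of the $\bar a_\beta$, the Łoś map is $L(\Delta)=\{\alpha<\lambda:\mathcal{M}_\alpha\models\exists\bar{x}\bigwedge_{\beta\in\Delta}\varphi(\bar{x},\bar{r}_\beta(\alpha))\}$ ($p$ being a type means $L(\Delta)\in\mathcal{D}$ for all $\Delta$). $p$ is graph-like if representatives can be chosen so that $L(\Delta)=\bigcap_{\Phi\in[\Delta]^2}L(\Phi)$ for all $\Delta$ with $|\Delta|\ge2$. Let $k_1(\alpha)=\{\beta:\alpha\in L(\{\beta\})\}$, $k_2(\alpha)=\{\{\beta,\gamma\}\in[\lambda]^2:\alpha\in L(\{\beta,\gamma\})\}$, $\mathrm{ess}(L)=\{\alpha:k_1(\alpha)\ne\emptyset\}$,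 $\mathcal{D}'=\{B\cap\mathrm{ess}(L):B\in\mathcal{D}\}$. The Łoś ultragraph is $\mathbb{G}_L=\prod_{\alpha\in\mathrm{ess}(L)}(k_1(\alpha),k_2(\alpha))/\mathcal{D}'$ (vertex set $k_1(\alpha)$, edge set $k_2(\alpha)$). For $\beta<\lambda$, $\eta_L(\beta)$ is the $\mathcal{D}'$-class of any $s\in\prod_{\alpha\in\mathrm{ess}(L)}k_1(\alpha)$ with $s(\alpha)=\beta$ whenever $\beta\in k_1(\alpha)$. A subset of $\mathbb{G}_L$ is internal if of the form $\prod_{\alpha\in\mathrm{ess}(L)}A_\alpha/\mathcal{D}'$ with $A_\alpha\subseteq k_1(\alpha)$. *)

(* Defs.v *)
From mathcomp Require Import all_boot all_classical.

Set Implicit Arguments.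
Unset Strict Implicit.
Unset Printing Implicit Defensive.

Local Open Scope classical_set_scope.
Local Open Scope card_scope.

Record language := Language {
  fsym : Type;
  fsym_ar : fsym -> nat;
  rsym : Type;
  rsym_ar : rsym -> nat }.

Record structure (L : language) := Structure {
  carrier :> Type;
  carrier_inhabited : inhabited carrier;
  fsym_interp : forall f : fsym L, ('I_(fsym_ar f) -> carrier) -> carrier;
  rsym_interp : forall P : rsym L, ('I_(rsym_ar P) -> carrier) -> Prop }.

Inductive term (L : language) (V : Type) : Type :=
| Var of V
| App (f : fsym L) of 'I_(fsym_ar f) -> term L V.

(* [V] is the type of free variables; under a quantifier it grows to          *)
(* [option V], [None] being the bound variable. The other connectives and the *)
(* existential quantifier are the usual classical abbreviations.              *)
Inductive formula (L : language) (V : Type) : Type :=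
| FEq of term L V & term L V
| FRel (P : rsym L) of 'I_(rsym_ar P) -> term L V
| FFalse
| FImp of formula L V & formula L V
| FAll of formula L (option V).

Fixpoint eval (L : language) (M : structure L) (V : Type) (e : V -> M)
    (t : term L V) : M :=
  match t with
  | Var v => e v
  | App f ts => fsym_interp (fun i => eval e (ts i))
  end.

Definition extend (T V : Type) (e : V -> T) (x : T) (o : option V) : T :=
  if o is Some v then e v else x.

Fixpoint sat (L : language) (M : structure L) (V : Type) (e : V -> M)
    (phi : formula L V) : Prop :=
  match phi with
  | FEq t u => eval e t = eval e u
  | FRel P ts => rsym_interp (fun i => eval e (ts i))
  | FFalse => False
  | FImp phi1 phi2 => sat e phi1 -> sat e phi2
  | FAll phi1 => forall x : M, sat (extend e x) phi1
  end.

Definition join_env (T : Type) (n m : nat) (x : 'I_n -> T) (y : 'I_m -> T)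
    (v : 'I_n + 'I_m) : T :=
  match v with inl i => x i | inr j => y j end.

Section Ultraproduct.
Variables (I : Type) (D : set_system I).

Section Quotient.
Variable X : I -> Type.

Definition ueq (s t : forall i, X i) : Prop := D [set i | s i = t i].

(* The quotient of [forall i, X i] by [ueq], as the type of its classes.      *)
Definition uprod : Type :=
  {c : set (forall i, X i) | exists s, c = [set t | ueq s t]}.

Definition uclass (s : forall i, X i) : uprod :=
  exist _ [set t | ueq s t] (ex_intro _ s erefl).

Definition urepr (c : uprod) : forall i, X i := projT1 (cid (proj2_sig c)).

Definition internal (A : set uprod) : Prop :=
  exists B : forall i, set (X i),
    A = [set uclass s | s in [set s | forall i, B i (s i)]].

End Quotient.

Variables (L : language) (M : I -> structure L).

Lemma uprod_inhabited : inhabited (uprod M).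
Proof.
have H i : exists x : M i, True by case: (carrier_inhabited (M i)) => x; exists x.
exact: inhabits (uclass (fun i => projT1 (cid (H i)))).
Qed.

Definition ultraproduct : structure L :=
  @Structure L (uprod M) uprod_inhabited
    (fun f xs => uclass (fun i => fsym_interp (fun j => urepr (xs j) i)))
    (fun P xs => D [set i | rsym_interp (fun j => urepr (xs j) i)]).

End Ultraproduct.

(* An ultrafilter on a set of cardinality lambda is regular when it contains  *)
(* lambda many sets such that each point lies in only finitely many of them.  *)
Definition regular_filter (Lam : Type) (D : set_system Lam) : Prop :=
  exists E : set_system Lam,
    [/\ E `<=` D, E #= [set: Lam] &
        forall alpha, finite_set [set X | E X /\ X alpha]].

(* [X]^2 *)
Definition pairs (T : Type) (X : set T) : set (set T) :=
  [set Phi | exists b c, [/\ X b, X c, b <> c & Phi = [set b; c]]].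

Definition graph_language : language :=
  @Language void (fun _ => 0) unit (fun _ => 2).

Definition tup2 (T : Type) (x y : T) (i : 'I_2) : T :=
  if val i == 0 then x else y.

Definition mk_graph (V : Type) (V_inh : inhabited V) (E : V -> V -> Prop) :
    structure graph_language :=
  @Structure graph_language V V_inh (fun f => match f with end)
    (fun=> fun xs : 'I_2 -> V => E (xs ord0) (xs ord_max)).

Definition edge (G : structure graph_language) (u v : G) : Prop :=
  @rsym_interp graph_language G tt (tup2 u v).

Definition induces_complete (G : structure graph_language) (A : set G) : Prop :=
  forall u v, A u -> A v -> u <> v -> edge u v.

Definition realized (L : language) (M : structure L) (Lam : Type) (n m : nat)
    (phi : formula L ('I_n + 'I_m)) (a : Lam -> 'I_m -> M) : Prop :=
  exists b : 'I_n -> M, forall beta, sat (join_env b (a beta)) phi.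

Section Los.
Variables (Lam : Type) (D : set_system Lam).
Variables (L : language) (M : Lam -> structure L) (n m : nat).
Variable phi : formula L ('I_n + 'I_m).
Variable r : Lam -> 'I_m -> forall alpha, M alpha.

Definition los (Delta : set Lam) : set Lam :=
  [set alpha | exists x : 'I_n -> M alpha,
     forall beta, Delta beta -> sat (join_env x (fun j => r beta j alpha)) phi].

(* By Los's theorem this says that the formulas phi(x, a_beta) are finitely   *)
(* satisfiable in the ultraproduct, a_beta being the class of [r beta].       *)
Definition is_type : Prop :=
  forall Delta : set Lam, finite_set Delta -> D (los Delta).

Definition graph_like_witness : Prop :=
  forall Delta : set Lam, finite_set Delta -> `I_2 #<= Delta ->
    los Delta = \bigcap_(Phi in pairs Delta) los Phi.

Definition k1 (alpha : Lam) : set Lam := [set beta | los [set beta] alpha].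

Definition k2 (alpha : Lam) : set (set Lam) :=
  [set Phi | pairs [set: Lam] Phi /\ los Phi alpha].

Definition ess : set Lam := [set alpha | k1 alpha !=set0].

Definition ess_idx : Type := {alpha : Lam | ess alpha}.

(* The sets [B `&` ess], B in D, regarded as sets of elements of [ess_idx].   *)
Definition ess_filter : set_system ess_idx :=
  [set sval @^-1` B | B in D].

Definition los_vertex (alpha : Lam) : Type := {beta : Lam | k1 alpha beta}.

Lemma los_vertex_inhabited (al : ess_idx) : inhabited (los_vertex (sval al)).
Proof. by case: al => alpha [beta kb]; exact: inhabits (exist _ beta kb). Qed.

Definition los_graph (al : ess_idx) : structure graph_language :=
  mk_graph (los_vertex_inhabited al)
    (fun u v => k2 (sval al) [set sval u; sval v]).

Definition los_ultragraph : structure graph_language :=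
  ultraproduct ess_filter los_graph.

Definition eta_fun (beta : Lam) (al : ess_idx) : los_graph al :=
  match pselect (k1 (sval al) beta) with
  | left kb => exist _ beta kb
  | right _ => let w := cid (proj2_sig al) in exist _ (projT1 w) (projT2 w)
  end.

Definition eta (beta : Lam) : los_ultragraph :=
  uclass ess_filter (eta_fun beta).

(* The values of [eta_fun beta] where beta is not in k1 are irrelevant.       *)
Lemma etaE (beta : Lam) (s : forall al, los_graph al) :
    Filter D -> is_type ->
    (forall al, k1 (sval al) beta -> sval (s al) = beta) ->
  eta beta = uclass ess_filter s.
Proof.
move=> FD ty sb.
pose es := eta_fun beta.
have ess_es al : k1 (sval al) beta -> es al = s al.
  move=> kb; rewrite /es /eta_fun; case: pselect => // kb'.
  by case: (s al) (sb _ kb) => b kb2 /= eb; exact: eq_exist.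
have DL : D (los [set beta]) by apply: ty; exact: finite_set1.
have up (C : set ess_idx) B : ess_filter C -> D B ->
    forall C' : set ess_idx,
    (forall al, C al -> B (sval al) -> C' al) -> ess_filter C'.
  move=> [B0 DB0 <-] DB C' CC'.
  exists [set alpha | forall h : ess alpha, C' (exist _ alpha h)].
    apply: (@filterS _ _ _ (B0 `&` B)); last exact: filterI.
    by move=> alpha [? ?] h; exact: CC'.
  by apply/seteqP; split => -[alpha h] /=; [exact|move=> c h'; rewrite (Prop_irrelevance h' h)].
apply: eq_exist; apply/seteqP; split => t /= et; apply: (up _ _ et DL) => al /= <- kb.
  by rewrite -ess_es.
by rewrite -/es ess_es.
Qed.

End Los.

(* Main.v *)
Require Import Defs.
From mathcomp Require Import all_boot all_classical.

Local Open Scope classical_set_scope.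

(** By Łoś's theorem a tuple [b] realizes the type iff, for each [beta], the set
    of indices [alpha] at which [b alpha] satisfies [phi(x, r_beta alpha)] is in
    [D]. Given such a [b], the parameters satisfied by [b alpha] form a clique of
    the graph [(k1 alpha, k2 alpha)], and the product of these cliques is the
    required internal set. Conversely, an internal complete set is almost
    everywhere a product of cliques [B alpha]. Regularity cuts each [B alpha]
    down to a finite clique such that every [beta] still lies in almost all of
    them; graph-likeness provides a common solution for a finite clique, and the
    class of these solutions realizes the type. *)

(** * Łoś's theorem for ultraproducts *)

Section Ultraproducts.
Context {I : Type} (D : set_system I).

Lemma ultra_notin (A : set I) : UltraFilter D -> ~ D A -> D (~` A).
Proof. by move=> UD nDA; case: (in_ultra_setVsetC A UD). Qed.

Lemma uclass_eqP {X : I -> Type} (s t : forall i, X i) :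
  Filter D -> (uclass D s = uclass D t <-> D [set i | s i = t i]).
Proof.
move=> FD; split => [[/predeqP/(_ t) [_]]|st].
  by apply; apply: filterE.
apply: eq_exist; apply/seteqP; split => u /= Du.
  by apply: filterS2 st Du => i /= -> ->.
by apply: filterS2 st Du => i /= -> ->.
Qed.

Lemma uclass_urepr {X : I -> Type} (c : uprod D X) : uclass D (urepr c) = c.
Proof.
case: c => c hc; apply: eq_exist.
by rewrite /urepr; case: cid => s /= ->.
Qed.

Lemma urepr_uclass {X : I -> Type} (s : forall i, X i) :
  Filter D -> D [set i | urepr (uclass D s) i = s i].
Proof. by move=> FD; apply/uclass_eqP; rewrite uclass_urepr. Qed.

Context {L : language} (M : I -> structure L).

(** Induction on the term. Arities are finite, so the almost-everywhere equalities for the arguments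
    can be intersected within the filter. *)
Lemma eval_ultraproduct {V : Type} (e : V -> ultraproduct D M) (t : term L V) :
  Filter D ->
  D [set i | urepr (eval e t) i = eval (fun v => urepr (e v) i) t].
Proof.
move=> FD; elim: t => [v|f ts IH] /=; first exact: filterE.
have Dts := filter_forall FD IH.
pose s i := fsym_interp (fun j => urepr (eval e (ts j)) i).
apply: filterS2 (urepr_uclass s FD) Dts => i /= -> ets.
by congr fsym_interp; apply/funext.
Qed.

Lemma los_theorem {V : Type} (e : V -> ultraproduct D M) (phi : formula L V) :
  UltraFilter D ->
  sat e phi <-> D [set i | sat (fun v => urepr (e v) i) phi].
Proof.
move=> UD; have FD : Filter D by exact: filter_filter.
elim: phi e => {V} [V t u|V P ts|V|V f IHf g IHg|V f IHf] e /=.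
- rewrite -(uclass_urepr (eval e t)) -(uclass_urepr (eval e u)) uclass_eqP.
  have Dt := eval_ultraproduct e t FD; have Du := eval_ultraproduct e u FD.
  by split; apply: filterS3 Du Dt => i /= -> ->.
- have Dts : D [set i | forall j, urepr (eval e (ts j)) i =
                                  eval (fun v => urepr (e v) i) (ts j)].
    by apply: filter_forall => j; exact: eval_ultraproduct.
  by split; apply: filterS2 Dts => i /= /funext ->.
- by split => //; rewrite -/set0 => /filter_not_empty.
- split=> [fg|Dfg /IHf Df]; last first.
    by apply/IHg; apply: filterS2 Dfg Df => i /= fg /fg.
  have [/IHf/fg/IHg|nDf] := pselect (D [set i | sat (fun v => urepr (e v) i) f]).
    by apply: filterS => i /=.
  by apply: filterS (ultra_notin _ UD nDf) => i /= nf /nf.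
- have extE x i : (fun v => urepr (extend e x v) i) =
      extend (fun v => urepr (e v) i) (urepr x i).
    by apply/funext => -[].
  split=> [all_f|Df x]; last first.
    by apply/IHf; apply: filterS Df => i /= fi; rewrite extE.
  (* At each index choose a counterexample to [f] if there is one, and any element otherwise.
     Testing the universal statement on the class of these choices alone decides it almost
     everywhere. *)
  have wit i : exists x, sat (extend (fun v => urepr (e v) i) x) f ->
      forall y, sat (extend (fun v => urepr (e v) i) y) f.
    have [[x nx]|ex] := pselect (exists x, ~ sat (extend (fun v => urepr (e v) i) x) f).
      by exists x.
    have [x] := carrier_inhabited (M i); exists x => _ y.
    by apply: contrapT => ny; apply: ex; exists y.
  pose s i := projT1 (cid (wit i)).
  have sP i := projT2 (cid (wit i)).
  have /IHf := all_f (uclass D s).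
  apply: filterS2 (urepr_uclass s FD) => i /= si.
  by rewrite extE si => /sP.
Qed.

(** Passes from the representatives picked by [urepr] to arbitrary ones. With finitely many
    variables, both choices agree at all variables simultaneously on a set in [D]. *)
Lemma los_theorem_rep {V : finType} (s : V -> forall i, M i)
    (phi : formula L V) :
  UltraFilter D ->
  sat (M := ultraproduct D M) (fun v => uclass D (s v)) phi <->
  D [set i | sat (fun v => s v i) phi].
Proof.
move=> UD; have FD : Filter D by exact: filter_filter.
have Ds : D [set i | forall v, urepr (uclass D (s v)) i = s v i].
  by apply: filter_forall => v; exact: urepr_uclass.
rewrite los_theorem.
by split; apply: filterS2 Ds => i /= /funext ->.
Qed.

Lemma los_theorem_join {n m : nat} (phi : formula L ('I_n + 'I_m))
    (x : 'I_n -> forall i, M i) (y : 'I_m -> forall i, M i) :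
  UltraFilter D ->
  sat (M := ultraproduct D M)
    (join_env (fun j => uclass D (x j)) (fun j => uclass D (y j))) phi <->
  D [set i | sat (join_env (fun j => x j i) (fun j => y j i)) phi].
Proof.
move=> UD; pose s (v : 'I_n + 'I_m) := match v with inl j => x j | inr j => y j end.
have -> : join_env (fun j => uclass D (x j)) (fun j => uclass D (y j)) =
    (fun v => uclass D (s v)) by apply/funext => -[].
rewrite los_theorem_rep.
have E i : join_env (fun j => x j i) (fun j => y j i) = (fun v => s v i).
  by apply/funext => -[].
by split; apply: filterS => i /=; rewrite E.
Qed.

End Ultraproducts.

(** Reindexes a regularizing family by [Lam] itself; injectivity of the indexing keeps the set of
    indices over each point finite. *)
Lemma regular_filter_family {Lam : Type} (D : set_system Lam) :
  regular_filter D ->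
  exists2 g : Lam -> set Lam,
    forall beta, D (g beta) & forall alpha, finite_set [set beta | g beta alpha].
Proof.
move=> [E [ED /card_esym/card_set_bijP [g [gE g_inj _]] fin]].
exists g => [beta|alpha]; first by apply/ED/gE.
have -> : [set beta | g beta alpha] = g @^-1` [set X | E X /\ X alpha].
  by apply/seteqP; split=> beta /=; [split=> //; exact: gE|case].
by apply: finite_preimage (fin alpha) => b c _ _; apply: g_inj; rewrite inE.
Qed.

(** * The Łoś graphs, their cliques and the filter on [ess] *)

Section LosGraph.
Context {Lam : Type} (D : set_system Lam) {L : language}.
Context (M : Lam -> structure L) {n m : nat} (phi : formula L ('I_n + 'I_m)).
Context (r : Lam -> 'I_m -> forall alpha, M alpha).

Local Notation Dess := (@ess_filter Lam D L M n m phi r).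
Local Notation los_graph := (@los_graph Lam L M n m phi r).

(** Graph-likeness settles sets with at least two elements; a singleton is covered by [k1], and the
    empty set by any element of the inhabited carrier. *)
Lemma los_finite_clique (Delta : set Lam) (alpha : Lam) :
    graph_like_witness phi r -> finite_set Delta -> Delta `<=` k1 phi r alpha ->
    (forall b c, Delta b -> Delta c -> b <> c -> k2 phi r alpha [set b; c]) ->
  los phi r Delta alpha.
Proof.
move=> gl fin_Delta Delta_k1 clique.
have [[b [c [Db Dc bc]]]|no_pair] :=
    pselect (exists b c, [/\ Delta b, Delta c & b <> c]).
  rewrite gl//; first by move=> _ [b' [c' [? ? ? ->]]]; have [] := clique b' c'.
  (* An injection of [I_2] into [Delta], which yields the cardinality bound required by
     graph-likeness. *)
  pose f k := if k is 0 then b else c.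
  have f_inj : {in `I_2 &, injective f}.
    by move=> [|[|k]] [|[|l]]; rewrite !inE//= => _ _ /esym/bc.
  rewrite -(card_le_eql (inj_card_eq f_inj)).
  by apply: subset_card_le => _ [[|k] _ <-].
have [[b Db]|Delta0] := pselect (Delta !=set0).
  have [x xb] := Delta_k1 b Db; exists x => c Dc; apply: xb.
  by apply: contrapT => cb; apply: no_pair; exists c, b.
have [x0] := carrier_inhabited (M alpha).
by exists (fun=> x0) => c Dc; case: Delta0; exists c.
Qed.

Lemma ess_filterP (C : set (ess_idx phi r)) : Filter D ->
  Dess C <->
  D [set alpha | forall h : ess phi r alpha, C (exist _ alpha h)].
Proof.
move=> FD; split=> [[B DB <-]|DC].
  by apply: filterS DB => alpha /= Balpha h.
exists [set alpha | forall h : ess phi r alpha, C (exist _ alpha h)] => //.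
apply/seteqP; split=> -[alpha h] /=; first exact.
by move=> c h'; rewrite (Prop_irrelevance h' h).
Qed.

Hypothesis D_ultra : UltraFilter D.
Hypothesis D_ess : D (ess phi r).

Lemma ess_filter_proper : ProperFilter Dess.
Proof.
split; last split.
- move/ess_filterP => D0; have [alpha [/= h0 h]] := filter_ex (filterI D0 D_ess).
  exact: h0.
- by apply/ess_filterP; exact: filterE.
- move=> P Q /ess_filterP DP /ess_filterP DQ; apply/ess_filterP.
  by apply: filterS2 DP DQ => alpha /= p q h; split.
- move=> P Q PQ /ess_filterP DP; apply/ess_filterP.
  by apply: filterS DP => alpha /= p h; apply/PQ/p.
Qed.

Lemma ess_filter_notin (C : set (ess_idx phi r)) :
  ~ Dess C -> Dess (~` C).
Proof.
move=> nC; apply/ess_filterP.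
have /(ultra_notin _ _ D_ultra) : ~ D [set alpha | forall h, C (exist (ess phi r) alpha h)].
  by move=> DC; apply/nC/ess_filterP.
by apply: filterS => alpha /= nh h c; apply: nh => h'; rewrite (Prop_irrelevance h' h).
Qed.

Lemma edge_los_ultragraphP (s t : forall al, los_graph al) :
  edge (G := los_ultragraph D phi r) (uclass _ s) (uclass _ t) <->
  Dess
    [set al | k2 phi r (sval al) [set sval (s al); sval (t al)]].
Proof.
have F' := @filter_filter _ _ ess_filter_proper.
have Ds := urepr_uclass _ s F'; have Dt := urepr_uclass _ t F'.
by split; apply: filterS3 Ds Dt => al /= -> ->.
Qed.

(** Otherwise choosing a non-adjacent pair of distinct vertices in almost every factor would give
    two distinct, non-adjacent elements of the internal set. *)
Lemma internal_complete_cliques (B : forall al, set (los_graph al)) :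
    (forall al, B al !=set0) ->
    induces_complete (G := los_ultragraph D phi r)
      [set uclass _ s | s in [set s | forall al, B al (s al)]] ->
  Dess [set al | forall u v, B al u -> B al v -> sval u <> sval v ->
    k2 phi r (sval al) [set sval u; sval v]].
Proof.
move=> B0 complete; apply: contrapT => /ess_filter_notin not_clique.
have F' := ess_filter_proper.
have wit al : exists uv : los_graph al * los_graph al,
    [/\ B al uv.1, B al uv.2 &
      (exists u v, [/\ B al u, B al v, sval u <> sval v &
         ~ k2 phi r (sval al) [set sval u; sval v]]) ->
      sval uv.1 <> sval uv.2 /\
      ~ k2 phi r (sval al) [set sval uv.1; sval uv.2]].
  have [[u [v [Bu Bv uv nk]]]|no] := pselect (exists u v, [/\ B al u, B al v,
      sval u <> sval v & ~ k2 phi r (sval al) [set sval u; sval v]]).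
    by exists (u, v).
  (* Default pair for a factor that is a clique, so that both choice functions stay inside [B]
     everywhere. *)
  by have [u Bu] := B0 al; exists (u, u).
pose s al := (projT1 (cid (wit al))).1; pose t al := (projT1 (cid (wit al))).2.
have Bs al : B al (s al) by rewrite /s; case: cid => ? [].
have Bt al : B al (t al) by rewrite /t; case: cid => ? [].
have {}not_clique : Dess [set al | sval (s al) <> sval (t al) /\
    ~ k2 phi r (sval al) [set sval (s al); sval (t al)]].
  apply: filterS not_clique => al /= nc; rewrite /s /t; case: cid => uv [_ _] /=; apply.
  apply: contrapT => no; apply: nc => u v Bu Bv uv'; apply: contrapT => nk.
  by apply: no; exists u, v.
have st : uclass Dess s <> uclass _ t.
  move/uclass_eqP => Dst; have [al [/= est []]] := filter_ex (filterI Dst not_clique).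
  by rewrite est.
have /edge_los_ultragraphP De : edge (G := los_ultragraph D phi r) (uclass _ s) (uclass _ t).
  by apply: complete => //; [exists s|exists t].
by have [al [/= k []]] := filter_ex (filterI De not_clique).
Qed.

End LosGraph.

(** * Realizations against internal complete subgraphs *)

Theorem theorem6p14 (Lam : Type) (Lam_infinite : infinite_set [set: Lam])
    (D : set_system Lam) (D_ultra : UltraFilter D) (D_regular : regular_filter D)
    (L : language) (M : Lam -> structure L) (n m : nat)
    (phi : formula L ('I_n + 'I_m))
    (a : Lam -> 'I_m -> ultraproduct D M)
    (r : Lam -> 'I_m -> forall alpha, M alpha)
    (r_represents : forall beta j, a beta j = uclass D (r beta j))
    (p_type : is_type D phi r)
    (p_graph_like : graph_like_witness phi r) :
  realized phi a <->
  exists A : set (los_ultragraph D phi r),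
    [/\ internal A, induces_complete A & range (eta D phi r) `<=` A].
Proof.
have FD : Filter D by exact: filter_filter.
have aE beta : a beta = fun j => uclass D (r beta j).
  by apply/funext => j; exact: r_represents.
have [beta0 _] : [set: Lam] !=set0.
  by apply/set0P/eqP => Lam0; apply: Lam_infinite; rewrite Lam0.
have D_ess : D (ess phi r).
  by apply: filterS (p_type _ (finite_set1 beta0)) => alpha k; exists beta0.
have F' := @filter_filter _ _ (ess_filter_proper D M phi r D_ultra D_ess).
split=> [[b b_real]|[_ [[B ->] complete etaB]]].
- pose x j := urepr (b j).
  have bE : b = fun j => uclass D (x j).
    by apply/funext => j; rewrite uclass_urepr.
  pose S alpha := [set beta | sat (join_env (x^~ alpha) (fun j => r beta j alpha)) phi].
  have DS beta : D [set alpha | S alpha beta].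
    by apply/los_theorem_join => //; rewrite -aE -bE.
  (* Where no parameter is satisfied, an empty factor would make the whole
     product empty, so an arbitrary vertex is used instead. *)
  pose B (al : ess_idx phi r) : set (los_graph al) := [set u | S (sval al) (sval u) \/
    (~ (S (sval al) !=set0) /\ u = eta_fun beta0 al)].
  exists [set uclass _ s | s in [set s | forall al, B al (s al)]]; split.
  + by exists B.
  + move=> _ _ [s Bs <-] [t Bt <-] st; apply/edge_los_ultragraphP => //.
    have := ess_filter_notin D M phi r D_ultra _ (fun e => st ((uclass_eqP _ s t F').2 e)).
    apply: filterS => al /= st_al.
    have sv_st : sval (s al) <> sval (t al).
      by move=> e; apply: st_al; case: (s al) (t al) e => ? ? [? ?] /= e; exact: eq_exist.
    split; first by exists (sval (s al)), (sval (t al)).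
    (* Two satisfied parameters are both solved by [x] at this index. The default vertex occurs only
       where nothing is satisfied, and there it is the only vertex of [B]. *)
    have [[Ss|[nS es]] [St|[nS' et]]] := (Bs al, Bt al).
    * by exists (x^~ (sval al)) => beta [->|->].
    * by case: nS'; exists (sval (s al)).
    * by case: nS; exists (sval (t al)).
    * by case: st_al; rewrite es et.
  + move=> _ [beta _ <-].
    (* [eta beta] needs a representative inside [B] at every index: take [beta] where it is
       satisfied, any vertex of [B] elsewhere. *)
    have wit al : exists u, B al u /\ (S (sval al) beta -> sval u = beta).
      have SK c : S (sval al) c -> k1 phi r (sval al) c.
        by move=> Sc; exists (x^~ (sval al)) => _ ->.
      have [Sb|nSb] := pselect (S (sval al) beta).
        by exists (exist _ beta (SK _ Sb)); split=> //; left.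
      have [[c Sc]|S0] := pselect (S (sval al) !=set0).
        by exists (exist _ c (SK _ Sc)); split=> //; left.
      by exists (eta_fun beta0 al); split=> //; right.
    pose s al := projT1 (cid (wit al)).
    have sP al : B al (s al) /\ (S (sval al) beta -> sval (s al) = beta).
      exact: projT2 (cid (wit al)).
    exists s; first by move=> al; have [] := sP al.
    apply/uclass_eqP/ess_filterP; apply: filterS (DS beta) => alpha /= Sb h.
    have [_ /(_ Sb)] := sP (exist _ alpha h).
    rewrite /eta_fun; case: pselect => [kb|[]]; last by exists (x^~ alpha) => _ ->.
    by case: (s _) => c kc /= cb; exact: eq_exist.
(* The internal set contains [eta] of [beta0], so none of its factors is empty. *)
- have B0 al : B al !=set0.
    by have [|s Bs _] := etaB (eta D phi r beta0); [exists beta0|exists (s al)].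
  have cliques := internal_complete_cliques D M phi r D_ultra D_ess B B0 complete.
  have [g Dg g_fin] := regular_filter_family D D_regular.
  pose S alpha := [set beta | exists (h : ess phi r alpha)
    (k : k1 phi r alpha beta), B (exist _ alpha h) (exist _ beta k)].
  have DS beta : D [set alpha | S alpha beta].
    have [|s Bs] := etaB (eta D phi r beta); first by exists beta.
    move=> /uclass_eqP/ess_filterP Dsb.
    (* Restricting to indices with [beta] in [k1] ensures that [eta_fun beta] is [beta] there and
       not its default value. *)
    apply: filterS3 Dsb D_ess (p_type _ (finite_set1 beta)) => alpha /= sb h k.
    exists h, k; have := Bs (exist _ alpha h); rewrite sb /eta_fun.
    by case: pselect => [k'|//]; rewrite (Prop_irrelevance k' k).
  have wit alpha : exists x : 'I_n -> M alpha,
      los phi r [set beta | g beta alpha /\ S alpha beta] alpha ->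
      forall beta, g beta alpha -> S alpha beta ->
        sat (join_env x (fun j => r beta j alpha)) phi.
    have [[x xP]|no] := pselect (los phi r [set beta | g beta alpha /\ S alpha beta] alpha).
      by exists x => _ beta gb Sb; exact: xP.
    by have [x0] := carrier_inhabited (M alpha); exists (fun=> x0).
  pose x j alpha := projT1 (cid (wit alpha)) j.
  exists (fun j => uclass D (x j)) => beta; rewrite aE; apply/los_theorem_join.
  move/ess_filterP: cliques => cliques.
  (* At such an index the parameters in both [g] and [S] form a finite clique containing [beta], so
     the chosen [x] solves them all, [beta] included. *)
  apply: filterS3 cliques (Dg beta) (DS beta) => alpha /= clique gb Sb.
  apply: (projT2 (cid (wit alpha))) => //; apply: los_finite_clique => //.
  + by apply: sub_finite_set (g_fin alpha) => c [].
  + by move=> c [_ [_ [k _]]].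
  + move=> c d [_ [h [kc Bc]]] [_ [h' [kd Bd]]] cd.
    move: Bd; rewrite (Prop_irrelevance h' h) => Bd.
    exact: clique h _ _ Bc Bd cd.
Qed.
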